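(* Let $X$ be a compact subset of the real line $\mathbb{R}$ with $|X|>1$. Then the set of functions in $C(X)$ with disconnected spectrum is dense in $C(X)$ (in the supremum norm) if and only if $X$ is not a union of finitely many disjoint closed intervals, where closed intervals are understood to be nondegenerate, i.e. of the form $[a,b]$ with $a<b$.
   Context: $|X|$ denotes the cardinality of $X$. $C(X)$ is the unital $C^*$-algebra of continuous complex-valued functions on $X$ with the supremum norm; the spectrum of $f\in C(X)$ is its range $f(X)$. *)

(* Defs.v *)
From HB Require Import structures.
From mathcomp Require Import all_boot all_order all_algebra.
From mathcomp Require Import complex.
From mathcomp Require Import all_classical all_reals all_analysis.

Set Implicit Arguments.
Unset Strict Implicit.
Unset Printing Implicit Defensive.

Import Order.TTheory GRing.Theory Num.Theory numFieldNormedType.Exports.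

Local Open Scope classical_set_scope.
Local Open Scope complex_scope.
Local Open Scope ring_scope.

(* The topology of C, induced by the modulus. *)
HB.instance Definition _ (R : rcfType) := NormedModule.copy R[i] R[i]^o.

Section complex_valued.
Context {R : realType}.

Lemma normRe (z : R[i]) : (complex.Re `|z|)%:C = `|z|.
Proof. by rewrite RRe_real// normr_real. Qed.

Lemma Re_norm_ge0 (z : R[i]) : 0 <= complex.Re `|z|.
Proof. by rewrite -lecR normRe normr_ge0. Qed.

Lemma Re_norm_continuous {T : topologicalType} (f : T -> R[i]) :
  continuous f -> continuous (fun x => complex.Re `|f x|).
Proof.
move=> cf x; apply/cvgrPdist_lt => e e0.
have e0' : 0 < e%:C :> R[i] by rewrite ltcR.
have /cvgrPdist_lt /(_ _ e0') := cf x.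
apply: filterS => y fxy.
rewrite -ltcR; apply: le_lt_trans fxy.
have -> : (`|complex.Re `|f x| - complex.Re `|f y| |)%:C = `| `|f x| - `|f y| |.
  rewrite -[in RHS]normRe -[X in _ = `|_ - X|]normRe -rmorphB /=.
  by rewrite normc_def /= expr0n addr0 sqrtr_sqr.
exact: ler_dist_dist.
Qed.

Lemma continuous_subV {T : topologicalType} (f : T -> R[i]) (z : R[i]) :
  continuous f -> (forall x, f x - z != 0) ->
  continuous (fun x => (f x - z)^-1).
Proof.
move=> cf fz0 x; apply: (cvgV (fz0 x)).
exact: (cvgB (cf x) (@cst_continuous T R[i] z x)).
Qed.

End complex_valued.

Section continuous_functions.
Context {R : realType} {X : set R}.

Definition cts : {pred (X -> R[i])} := [pred f | `[< continuous f >]].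

Lemma ctsP (f : X -> R[i]) : reflect (continuous f) (f \in cts).
Proof. exact: asboolP. Qed.

Lemma cts_subring_closed : subring_closed cts.
Proof.
split.
- by apply/ctsP; exact: (@cst_continuous X R[i] 1).
- move=> f g /ctsP cf /ctsP cg; apply/ctsP => x.
  exact: (cvgB (cf x) (cg x)).
- move=> f g /ctsP cf /ctsP cg; apply/ctsP => x.
  exact: (continuousM (cf x) (cg x)).
Qed.

Lemma cts_submod_closed : submod_closed cts.
Proof.
split; first by apply/ctsP; exact: (@cst_continuous X R[i] 0).
move=> a f g /ctsP cf /ctsP cg; apply/ctsP => x.
exact: (cvgD (cvgZl_tmp (k := a) (cf x)) (cg x)).
Qed.

HB.instance Definition _ := GRing.isSubringClosed.Build _ cts
  cts_subring_closed.
HB.instance Definition _ := GRing.isSubmodClosed.Build _ _ cts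
  cts_submod_closed.

End continuous_functions.

(* The algebra C(X).  The compactness proof is a parameter of the type because
   the supremum norm is a norm only when continuous functions are bounded. *)
Record cfun (R : realType) (X : set R) (cX : compact X) := CFun {
  cfun_val :> X -> R[i] ;
  cfun_valP : cfun_val \in cts }.

Section cfun.
Context {R : realType} {X : set R} {cX : compact X}.
Local Notation CX := (cfun cX).
Implicit Types f g : CX.

HB.instance Definition _ := [isSub for @cfun_val R X cX].
HB.instance Definition _ := [Choice of CX by <:].
HB.instance Definition _ := GRing.SubChoice_isSubComPzRing.Build
  (X -> R[i]) cts CX cts_subring_closed.
HB.instance Definition _ := [SubZmodule_isSubLmodule of CX by <:].

Lemma cfun_continuous f : continuous f.
Proof. by apply/ctsP; exact: cfun_valP. Qed.

Lemma cfunP f g : f =1 g -> f = g.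
Proof. by move=> fg; apply/val_inj/funext. Qed.

Lemma supnorm_has_ub f : has_ubound (range (fun x => complex.Re `|f x|)).
Proof.
pose h := valL_ 0 (fun x : X => complex.Re `|f x|).
have ch : {within X, continuous h}.
  by apply/subspace_valL_continuousP'; exact/Re_norm_continuous/cfun_continuous.
have [M [_ HM]] := compact_bounded (continuous_compact ch cX).
exists (M + 1) => _ [x _ <-].
apply: le_trans (ler_norm _) (HM (M + 1) _ _ _); first by rewrite ltrDl.
exists (set_val x); first exact/set_mem/(valP x).
by rewrite /h -[LHS]/(sigL X (valL_ 0 _) x) valLK.
Qed.

(* The modulus [`|f x|] is an element of [R[i]]; [complex.Re] reads it in [R]. *)
Definition supnorm f : R := sup (range (fun x => complex.Re `|f x|)).

Lemma supnorm_ge f x : complex.Re `|f x| <= supnorm f.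
Proof. by apply: ub_le_sup; [exact: supnorm_has_ub | exists x]. Qed.

Lemma supnorm_le f (M : R) : 0 <= M ->
  (forall x, complex.Re `|f x| <= M) -> supnorm f <= M.
Proof.
move=> M0 fM; rewrite /supnorm; set A := (X in sup X).
have [->|/set0P A0] := eqVneq A set0; first by rewrite sup0.
by apply: ge_sup => // _ [x _ <-]; exact: fM.
Qed.

Lemma supnorm_ge0 f : 0 <= supnorm f.
Proof.
rewrite /supnorm; set A := (X in sup X).
have [->|/set0P[_ [x _ _]]] := eqVneq A set0; first by rewrite sup0.
exact: le_trans (Re_norm_ge0 (f x)) (supnorm_ge f x).
Qed.

Definition cfun_norm f : R[i] := (supnorm f)%:C.

Lemma cfun_normD f g : cfun_norm (f + g) <= cfun_norm f + cfun_norm g.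
Proof.
rewrite /cfun_norm -rmorphD lecR; apply: supnorm_le => [|x].
  by rewrite addr_ge0 ?supnorm_ge0.
apply: (@le_trans _ _ (complex.Re `|f x| + complex.Re `|g x|)).
  by rewrite -lecR rmorphD /= !normRe; exact: ler_normD.
by apply: lerD; exact: supnorm_ge.
Qed.

Lemma supnormZ_le (l : R[i]) f : supnorm (l *: f) <= complex.Re `|l| * supnorm f.
Proof.
apply: supnorm_le => [|x]; first by rewrite mulr_ge0 ?Re_norm_ge0 ?supnorm_ge0.
apply: (@le_trans _ _ (complex.Re `|l| * complex.Re `|f x|)).
  by rewrite -lecR rmorphM /= !normRe -normrM.
by apply: ler_wpM2l; [exact: Re_norm_ge0 | exact: supnorm_ge].
Qed.

Lemma cfun_normZ (l : R[i]) f : cfun_norm (l *: f) = `|l| * cfun_norm f.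
Proof.
rewrite /cfun_norm -[in RHS]normRe -rmorphM; congr (_%:C).
apply/eqP; rewrite eq_le supnormZ_le andTb.
have [->|l0] := eqVneq l 0; first by rewrite normr0 mul0r supnorm_ge0.
have l_gt0 : 0 < complex.Re `|l| by rewrite -ltcR normRe normr_gt0.
have /(ler_wpM2l (ltW l_gt0)) := supnormZ_le l^-1 (l *: f).
rewrite scalerA mulVf// scale1r => /le_trans; apply.
rewrite mulrA (_ : complex.Re `|l| * _ = 1) ?mul1r//.
by apply: (@complexI R); rewrite rmorphM /= !normRe -normrM mulfV// normr1.
Qed.

Lemma cfun_norm0_eq0 f : cfun_norm f = 0 -> f = 0.
Proof.
move=> /(@complexI R) f0; apply: cfunP => x; apply/eqP.
rewrite -normr_eq0 -normRe; apply/eqP; congr (_%:C).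
by apply/eqP; rewrite eq_le Re_norm_ge0 andbT -f0 supnorm_ge.
Qed.

HB.instance Definition _ := Lmodule_isNormed.Build R[i] CX
  cfun_normD cfun_normZ cfun_norm0_eq0.

Lemma cfun_normE f : `|f| = (sup (range (fun x => complex.Re `|f x|)))%:C.
Proof. by []. Qed.

Lemma cfun_denseP (S : set CX) : dense S <->
  forall f (e : R), 0 < e -> exists2 g, S g & supnorm (f - g) < e.
Proof.
split => [dS f e e0 | dS O [f Of] oO].
  have e0' : 0 < e%:C :> R[i] by rewrite ltcR.
  have [|g [/interior_subset + Sg]] := dS _ _ (@open_interior _ (ball f e%:C)).
    by exists f; exact: nbhsx_ballx.
  by rewrite -ball_normE /ball_ /= cfun_normE ltcR => fg; exists g.
have /nbhs_ballP[e /= e0 feO] : nbhs f O by exact: open_nbhs_nbhs.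
have eE : (complex.Re e)%:C = e by rewrite RRe_real// gtr0_real.
have [|g Sg fg] := dS f (complex.Re e); first by rewrite -ltcR eE.
exists g; split => //; apply: feO.
by rewrite -ball_normE /ball_ /= cfun_normE -eE ltcR.
Qed.

(* The C*-algebraic spectrum; [spectrumE] identifies it with the range. *)
Definition spectrum f : set R[i] :=
  [set z : R[i] | ~ exists g, (f - z *: (1 : CX)) * g = 1].

Lemma spectrumE f : spectrum f = range f.
Proof.
apply/seteqP; split => [z /= nz | _ [x _ <-] [g /(congr1 (fun h : CX => h x))]].
  apply: contrapT => zf; apply: nz.
  have fz0 x : f x - z != 0.
    by rewrite subr_eq0; apply/eqP => fxz; apply: zf; exists x.
  have cg : (fun x => (f x - z)^-1) \in @cts R X.
    by apply/ctsP/continuous_subV => //; exact: cfun_continuous.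
  exists (CFun cX cg); apply: cfunP => x.
  rewrite -[LHS]/((f x - z * 1) * (f x - z)^-1) mulr1 mulfV//.
rewrite -[LHS]/((f x - f x * 1) * g x) mulr1 subrr mul0r => /esym/eqP.
by rewrite -[X in X == _]/(1 : R[i]) oner_eq0.
Qed.

End cfun.

Definition finite_disjoint_union_itvcc {R : realType} (X : set R) : Prop :=
  exists (n : nat) (a b : 'I_n -> R),
    [/\ forall i, a i < b i,
        trivIset [set: 'I_n] (fun i => [set` `[a i, b i]]) &
        X = \bigcup_(i : 'I_n) [set` `[a i, b i]] ].

(* Main.v *)
(** Suppose that [X] is the disjoint union of segments.  Let [f] map one of them
    affinely onto the real segment [-1, 1] and all the others onto its rotation
    by [i].  For [g] uniformly close to [f], the image under [g] of the first
    segment still crosses the images of all the others, by the Poincaré–Miranda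
    theorem, so the range of [g] is connected.

    Otherwise there are a point [x0] of [X] and, arbitrarily close to it,
    nonempty clopen parts [K] of [X] cut out by two points [p < q] outside [X].
    Given [f = u + i v], replace [u] by a piecewise linear approximation [w].
    For [t] outside the finitely many values at the nodes, the level set
    [w = t] is finite, so [w + i v] avoids [t + i s] for all but finitely many
    [s].  Choosing [t + i s] close to [f x0], the function equal to [t + i s] on
    [K] and to [w + i v] elsewhere is close to [f], and [t + i s] is an isolated
    point of its range. *)

Require Import Defs.
From mathcomp Require Import all_boot all_order all_algebra.
From mathcomp Require Import complex finmap.
From mathcomp Require Import all_classical all_reals all_analysis.
From mathcomp Require Import lra ring.

Import Order.TTheory GRing.Theory Num.Theory numFieldNormedType.Exports.

Local Open Scope classical_set_scope.
Local Open Scope card_scope.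
Local Open Scope ring_scope.

Set Implicit Arguments.
Unset Strict Implicit.

(** * A planar Poincaré-Miranda theorem *)

(* Sperner's parity argument: along each row, count modulo 2 the edges with [b]
   false at both ends across which [a] changes.  If no cell has a change of both
   [a] and [b], this parity is the same for all rows; it is odd on the bottom row
   and even on the top row. *)
Lemma grid_sign_change (n m : nat) (a b : nat -> nat -> bool) :
  (forall j, (j <= m)%N -> ~~ a 0%N j) -> (forall j, (j <= m)%N -> a n j) ->
  (forall i, (i <= n)%N -> ~~ b i 0%N) -> (forall i, (i <= n)%N -> b i m) ->
  exists i j, [/\ (i < n)%N, (j < m)%N,
    ~~ [&& a i j == a i.+1 j, a i j == a i j.+1 & a i j == a i.+1 j.+1] &
    ~~ [&& b i j == b i.+1 j, b i j == b i j.+1 & b i j == b i.+1 j.+1]].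
Proof.
move=> a0 an b0 bm; apply: contrapT => noij.
pose e i j i' j' := [&& ~~ b i j, ~~ b i' j' & a i j (+) a i' j'].
pose S j := fix S i := if i is i'.+1 then S i' (+) e i' j i'.+1 j else false.
(* The edges around a cell cancel modulo 2. If [a] is constant on the cell, no edge counts. If [b]
   is constant there, either no edge counts or all changes of [a] count, and a closed walk has an
   even number of them. *)
have square i j : (i < n)%N -> (j < m)%N ->
    e i j i.+1 j (+) e i j.+1 i.+1 j.+1 = e i j i j.+1 (+) e i.+1 j i.+1 j.+1.
  move=> ilt jlt; have := noij; rewrite /e => nij.
  apply: contrapT => eij; apply: nij; exists i, j; split=> //; move: eij;
  by case: (a i j) (a i.+1 j) (a i j.+1) (a i.+1 j.+1) => [] [] [] [];
     case: (b i j) (b i.+1 j) (b i j.+1) (b i.+1 j.+1) => [] [] [] [].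
have rows j : (j < m)%N -> S j n = S j.+1 n.
  (* The squares of the strip telescope: the parts of two consecutive rows up to column [i] differ
     by the vertical edge at [i]. At [i = n] this edge does not count, because [a] is true at both
     its ends. *)
  move=> jm; suff /(_ n (leqnn n)) : forall i, (i <= n)%N ->
      S j i (+) S j.+1 i = e i j i j.+1.
    have -> : e n j n j.+1 = false by rewrite /e (an _ (ltnW jm)) (an _ jm) !andbF.
    by case: (S j n) (S j.+1 n) => [] [].
  elim=> [_|i IH ilt /=].
    by rewrite /e (negbTE (a0 _ (ltnW jm))) (negbTE (a0 _ jm)) !andbF.
  have := square i j ilt jm; rewrite -(IH (ltnW ilt)).
  by case: (S j i) (S j.+1 i) (e _ _ _ _) (e _ _ _ _) (e _ _ _ _)
    => [] [] [] [] [].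
have S0 i : (i <= n)%N -> S 0%N i = a i 0%N.
  elim: i => [_|i IH ilt] /=; first by rewrite (negbTE (a0 _ (leq0n _))).
  rewrite (IH (ltnW ilt)) /e !b0// 1?ltnW//=.
  by case: (a i 0%N) (a i.+1 0%N) => [] [].
have Sm i : (i <= n)%N -> S m i = false.
  by elim: i => [//|i IH ilt] /=; rewrite (IH (ltnW ilt)) /e bm// ltnW.
have /(_ m (leqnn m)) : forall j, (j <= m)%N -> S j n = true.
  elim=> [_|j IH jm]; first by rewrite S0// an.
  by rewrite -rows// IH// ltnW.
by rewrite Sm.
Qed.

(** Without a common zero, compactness of the rectangle yields a radius [e] such that on the ball of
    radius [e] around each of its points [u] or [v] has constant sign. On a grid of mesh below [e],
    [grid_sign_change] applied to the signs of [u] and [v] finds a cell where both change. *)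
Lemma poincare_miranda (R : realType) (u v : R * R -> R) (a b c d : R) :
  a <= b -> c <= d -> continuous u -> continuous v ->
  (forall y, c <= y <= d -> u (a, y) < 0) ->
  (forall y, c <= y <= d -> 0 < u (b, y)) ->
  (forall x, a <= x <= b -> v (x, c) < 0) ->
  (forall x, a <= x <= b -> 0 < v (x, d)) ->
  exists x y, [/\ a <= x <= b, c <= y <= d, u (x, y) = 0 & v (x, y) = 0].
Proof.
move=> ab cd cu cv ua ub vc vd; apply: contrapT => nouv.
pose K := `[a, b]%classic `*` `[c, d]%classic.
have cK : compact K by apply: compact_setX; exact: segment_compact.
pose P (e : R) (p : R * R) :=
  (exists s, forall q, ball p e q -> (0 < u q) = s) \/
  (exists s, forall q, ball p e q -> (0 < v q) = s).
(* The Lebesgue number: near each point of [K], [u] or [v] has constant sign. *)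
have sgn (w : R * R -> R) p : continuous w -> w p != 0 ->
    \forall p' \near p & e \near 0^'+,
      exists s, forall q, ball p' e q -> (0 < w q) = s.
  move=> cw wp; have [s /nbhs_ballP[r /= r0 rs]] :
      exists s, \forall q \near p, (0 < w q) = s.
    have [wp0|wp0|wp0] := ltgtP (w p) 0; last by rewrite wp0 eqxx in wp.
      exists false; have /cvgr_lt/(_ _ wp0) := cw p; apply: filterS => q.
      by move=> /ltW; rewrite leNgt => /negbTE.
    by exists true; have /cvgr_gt/(_ _ wp0) := cw p; apply: filterS => q ->.
  have r2 : 0 < r / 2 by rewrite divr_gt0.
  near=> p' e; exists s => q p'q; apply: rs; apply: (@ball_split _ _ p').
    suff: ball p (r / 2) p' by [].
    by near: p'; exact: nbhsx_ballx.
  apply: le_ball p'q; suff: e <= r / 2 by [].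
  by near: e; exact: nbhs_right_le.
have KP : forall p, K p -> \forall p' \near p & e \near 0^'+, P e p'.
  move=> [x y] [/=]; rewrite !in_itv /= => xab ycd.
  have [u0|/(sgn u _ cu) u0] := eqVneq (u (x, y)) 0; last first.
    by apply: filterS u0 => -[p' e] /= ?; left.
  have [v0|/(sgn v _ cv) v0] := eqVneq (v (x, y)) 0; last first.
    by apply: filterS v0 => -[p' e] /= ?; right.
  by exfalso; apply: nouv; exists x, y.
have {}KP := (compact_near_coveringP K).1 cK R 0^'+ P _ KP.
near (0 : R)^'+ => e.
have e0 : 0 < e by [].
have Pe : K `<=` P e by near: e; exact: KP.
near \oo => n.
have n0 : (0 < n)%N by near: n; exact: nbhs_infty_gt.
have n0' : 0 < n%:R :> R by rewrite ltr0n.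
have step (l r : R) : l <= r -> (r - l) / e < n%:R ->
  exists x : nat -> R, [/\ x 0%N = l, x n = r,
    forall i, (i <= n)%N -> l <= x i <= r & forall i, `|x i - x i.+1| < e].
  move=> lr lrn; exists (fun i => l + (r - l) * (i%:R / n%:R)); split.
  - by rewrite mul0r mulr0 addr0.
  - by rewrite divff ?lt0r_neq0// mulr1 addrC subrK.
  - move=> i iln; have i1 : i%:R / n%:R <= 1 :> R by rewrite ler_pdivrMr// mul1r ler_nat.
    have i0 : 0 <= i%:R / n%:R :> R by rewrite divr_ge0.
    nra.
  - move=> i; rewrite -natr1 (_ : _ - _ = - ((r - l) / n%:R)); last first.
      by field; rewrite lt0r_neq0.
    rewrite normrN ger0_norm; last by rewrite divr_ge0// ?subr_ge0// ltW.
    by rewrite ltr_pdivrMr// mulrC -ltr_pdivrMr.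
have nx : (b - a) / e < n%:R by near: n; exact: nbhs_infty_gtr.
have ny : (d - c) / e < n%:R by near: n; exact: nbhs_infty_gtr.
have [x [x0 xn xab xe]] := step a b ab nx.
have [y [y0 yn ycd ye]] := step c d cd ny.
(* Distances in the product are maxima over the coordinates, so the ball around the lower left
   corner of a cell contains its four corners. *)
have near_corner i j i' j' : (i' == i) || (i' == i.+1) ->
    (j' == j) || (j' == j.+1) -> ball (x i, y j) e (x i', y j').
  by move=> /orP[] /eqP -> /orP[] /eqP ->; split=> /=;
    rewrite -ball_normE /ball_ /= ?subrr ?normr0.
have [] := @grid_sign_change n n
  (fun i j => 0 < u (x i, y j)) (fun i j => 0 < v (x i, y j)).
- by move=> j /ycd /ua; rewrite x0 => /ltW; rewrite leNgt.
- by move=> j /ycd /ub; rewrite xn.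
- by move=> i /xab /vc; rewrite y0 => /ltW; rewrite leNgt.
- by move=> i /xab /vd; rewrite yn.
move=> i [j [ilt jlt]]; have [] : P e (x i, y j).
- by apply: Pe; split; rewrite /= in_itv /=; [apply: xab|apply: ycd]; exact: ltnW.
- by move=> [s us] /negP[]; rewrite !us ?eqxx//; apply: near_corner; rewrite eqxx ?orbT.
- by move=> [s vs] _ /negP[]; rewrite !vs ?eqxx//; apply: near_corner; rewrite eqxx ?orbT.
Unshelve. all: by end_near. Qed.

(** * Real and imaginary parts, extension and gluing of continuous functions *)

Lemma Re_normc_le (R : rcfType) (z : R[i]) :
  complex.Re `|z| <= `|complex.Re z| + `|complex.Im z|.
Proof.
case: z => x y; rewrite normc_def /=.
rewrite (_ : `|x| + `|y| = Num.sqrt ((`|x| + `|y|) ^+ 2)); last first.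
  by rewrite sqrtr_sqr [RHS]ger0_norm ?addr_ge0.
apply: ler_wsqrtr.
by rewrite sqrrD !real_normK ?num_real// lerD2r lerDl mulrn_wge0 ?mulr_ge0.
Qed.

Lemma normr_Re_le (R : rcfType) (z : R[i]) : `|complex.Re z| <= complex.Re `|z|.
Proof.
case: z => x y; rewrite normc_def /= -sqrtr_sqr; apply: ler_wsqrtr.
by rewrite lerDl sqr_ge0.
Qed.

Lemma normr_Im_le (R : rcfType) (z : R[i]) : `|complex.Im z| <= complex.Re `|z|.
Proof.
case: z => x y; rewrite normc_def /= -sqrtr_sqr; apply: ler_wsqrtr.
by rewrite lerDr sqr_ge0.
Qed.

Lemma continuous_complex (R : realType) (T : topologicalType) (u v : T -> R) :
  continuous u -> continuous v -> continuous (fun x => Complex (u x) (v x) : R[i]).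
Proof.
move=> cu cv x; apply/cvgrPdist_lt => e e0.
have eE : (complex.Re e)%:C%C = e by rewrite RRe_real// gtr0_real.
have e2 : 0 < complex.Re e / 2 by rewrite divr_gt0// -ltcR eE.
near=> y; rewrite -normRe -eE ltcR; apply: le_lt_trans (Re_normc_le _) _.
rewrite [ltRHS]splitr /=; apply: ltrD; near: y.
  by have /cvgrPdist_lt/(_ _ e2) := cu x.
by have /cvgrPdist_lt/(_ _ e2) := cv x.
Unshelve. all: by end_near. Qed.

(** By additivity the bound makes [h] 1-Lipschitz. It is applied to the real and imaginary parts. *)
Lemma continuous_contraction (R : realType) (T : topologicalType)
    (h : {additive R[i] -> R}) (f : T -> R[i]) :
  (forall z, `|h z| <= complex.Re `|z|) -> continuous f ->
  continuous (fun x => h (f x)).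
Proof.
move=> hle cf x; apply/cvgrPdist_lt => e e0.
have e0' : 0 < e%:C%C :> R[i] by rewrite ltcR.
have /cvgrPdist_lt /(_ _ e0') := cf x.
apply: filterS => y fxy; rewrite -raddfB; apply: le_lt_trans (hle _) _.
by rewrite -ltcR normRe.
Qed.

(** Tietze's theorem for the closed set [X], [f] being bounded by compactness. It allows all later
    constructions to be made on the real line instead of the subtype [X]. *)
Lemma continuous_extension (R : realType) (X : set R) (f : X -> R) :
  compact X -> continuous f ->
  exists u : R -> R, continuous u /\ forall x : X, f x = u (val x).
Proof.
move=> cX /(@subspace_valL_continuousP' R X R 0) cf.
have [M [_ HM]] := compact_bounded (continuous_compact cf cX).
have M1 : 0 < `|M| + 1 by rewrite ltr_wpDl.
have HM1 : forall x, X x -> `|valL_ (0 : R) f x| <= `|M| + 1.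
  move=> x Xx; apply: (HM (`|M| + 1)); last by exists x.
  by rewrite (le_lt_trans (ler_norm M))// ltrDl.
have [g [fg cg _]] := continuous_bounded_extension
  (@pseudometric_normal R R) (compact_closed (@Rhausdorff R) cX) M1 cf HM1.
exists g; split=> // x; rewrite -fg; last exact: (valP x).
by rewrite -[LHS]/(f x) -[RHS]/(sigL X (valL_ 0 _) x) valLK.
Qed.

(** Finitely many disjoint closed sets that cover the space are also open, so the index [k x] of the
    piece containing [x] is locally constant. *)
Lemma continuous_glue (T U : topologicalType) (J : finType) (A : J -> set T)
    (F : J -> T -> U) :
  (forall i, closed (A i)) -> trivIset setT A -> \bigcup_i A i = setT ->
  (forall i, continuous (F i)) ->
  exists f : T -> U, continuous f /\ forall i x, A i x -> f x = F i x.
Proof.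
move=> clA tA AT cF.
have /choice[k kP] : forall x : T, exists i, A i x.
  by move=> x; have [i _ Ai] : (\bigcup_i A i) x by [rewrite AT]; exists i.
have kE i x : A i x -> k x = i by move=> Ai; apply: (tA _ _ I I); exists x.
exists (fun x => F (k x) x); split=> [x|i x /kE -> //].
have kx : \forall y \near x, k y = k x.
  have : \forall y \near x, forall i, i != k x -> ~ A i y.
    apply: filter_forall => i; have [->|ik] := eqVneq i (k x); first exact: nearW.
    have : open (~` A i) by exact: closed_openC.
    rewrite openE => /(_ x) oA.
    have : ~ A i x by move=> Ai; rewrite (kE _ _ Ai) eqxx in ik.
    by move=> /oA; apply: filterS.
  apply: filterS => y Ay; apply: contrapT => /eqP kyx.
  exact: Ay kyx (kP y).
apply: cvg_trans (cF (k x) x); apply: near_eq_cvg.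
by apply: filterS kx => y /= ->.
Qed.

Section cfun_real.
Context {R : realType} {X : set R} {cX : compact X}.

Lemma cfun_Re_Im (f : cfun cX) : exists u v : R -> R,
  [/\ continuous u, continuous v & forall x : X, f x = Complex (u (val x)) (v (val x))].
Proof.
have cf := cfun_continuous (f := f).
have [u [cu fu]] := continuous_extension cX (continuous_contraction (@normr_Re_le R) cf).
have [v [cv fv]] := continuous_extension cX (continuous_contraction (@normr_Im_le R) cf).
exists u, v; split=> // x; rewrite -fu -fv; by case: (f x).
Qed.

Lemma cfun_glue (J : finType) (A : J -> set R) (u v : J -> R -> R) :
  (forall i, closed (A i)) -> trivIset setT A -> X `<=` \bigcup_i A i ->
  (forall i, continuous (u i)) -> (forall i, continuous (v i)) ->
  exists f : cfun cX, forall i (x : X), A i (val x) ->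
    f x = Complex (u i (val x)) (v i (val x)).
Proof.
move=> clA tA XA cu cv.
have cval : continuous (val : X -> R) by exact: initial_continuous.
have [|||i|f [cf fF]] := @continuous_glue X R[i] J (fun i => val @^-1` A i)
  (fun i x => Complex (u i (val x)) (v i (val x))).
- by move=> i; exact: closed_comp (clA i).
- by move=> i j _ _ [x [Ai Aj]]; apply: (tA _ _ I I); exists (val x).
- apply/seteqP; split=> // x _; have [i _ Ai] := XA (val x) (set_mem (valP x)).
  by exists i.
- by apply: continuous_complex => x; apply: continuous_comp;
    [exact: cval|exact: cu|exact: cval|exact: cv].
have cf' : f \in @cts R X by exact/ctsP.
by exists (CFun cX cf') => i x /fF.
Qed.

End cfun_real.

(** * Approximation by functions with finite level sets *)

(** Only [x] is confined to the segment: [y] will be a node of a subdivision, and the last node may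
    lie beyond [b]. *)
Lemma continuous_uniform_segment (R : realType) (u : R -> R) (a b e : R) :
  continuous u -> 0 < e -> exists2 d, 0 < d &
  forall x y, a <= x <= b -> `|x - y| < d -> `|u x - u y| < e.
Proof.
move=> cu e0.
pose P (d x : R) := forall y, `|x - y| < d -> `|u x - u y| < e.
have KP : forall x, `[a, b]%classic x -> \forall x' \near x & d \near 0^'+, P d x'.
  move=> x _; have e2 : 0 < e / 2 by rewrite divr_gt0.
  have /cvgrPdist_lt/(_ _ e2)/nbhs_ballP[r /= r0 xr] := cu x.
  have r2 : 0 < r / 2 by rewrite divr_gt0.
  near=> x' d => y x'y.
  have xx' : ball x (r / 2) x' by near: x'; exact: nbhsx_ballx.
  have dr : d <= r / 2 by near: d; exact: nbhs_right_le.
  have xy : ball x r y.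
    by apply: (@ball_split _ _ x') => //; rewrite -ball_normE /ball_ /= (lt_le_trans x'y).
  have xr2 : ball x r x' by apply: le_ball xx'; rewrite ler_pdivrMr// ler_peMr ?ler1n// ltW.
  rewrite (splitr e) (_ : u x' - u y = (u x - u y) - (u x - u x')); last by ring.
  apply: le_lt_trans (ler_normB _ _) _; apply: ltrD; exact: xr.
have {}KP := (compact_near_coveringP _).1 (@segment_compact R a b) R 0^'+ P _ KP.
near (0 : R)^'+ => d; exists d => // x y xab.
have : `[a, b]%classic `<=` P d by near: d; exact: KP.
by apply; rewrite /= in_itv.
Unshelve. all: by end_near. Qed.

(* The approximant is piecewise linear: away from its values at the nodes it
   takes each value at most once between two consecutive nodes. *)
Lemma finite_levels_approx (R : realType) (u : R -> R) (a b e : R) :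
  continuous u -> 0 < e -> exists (w : R -> R) (F : set R),
  [/\ continuous w, finite_set F,
      forall x, a <= x <= b -> `|u x - w x| <= e &
      forall t, ~ F t -> finite_set (w @^-1` [set t])].
Proof.
move=> cu e0; have [d d0 ud] := @continuous_uniform_segment _ u a b _ cu e0.
pose h := d / 2; have h0 : 0 < h by rewrite divr_gt0.
have hd : h < d by rewrite /h; lra.
pose x_ (k : nat) := a + h *+ k.
have xS k : x_ k.+1 = x_ k + h by rewrite /x_ mulrSr addrA.
(* Induction on the number of nodes. To the right of the last node [w] is constant, and [F] contains
   this constant, whose level set is infinite. *)
suff step : forall k, exists (w : R -> R) (F : set R),
  [/\ continuous w, finite_set F,
      (forall x, a <= x <= b -> x <= x_ k -> `|u x - w x| <= e) /\
      (forall t, ~ F t -> finite_set (w @^-1` [set t])),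
      F (u (x_ k)) & forall x, x_ k <= x -> w x = u (x_ k)].
  near \oo => n.
  have [w [F [cw finF [uw lw] _ _]]] := step n.
  exists w, F; split=> // x xab; apply: uw => //.
  have bn : (b - a) / h < n%:R by near: n; exact: nbhs_infty_gtr.
  rewrite ltr_pdivrMr// mulr_natl in bn; rewrite /x_; lra.
elim=> [|k [w [F [cw finF [uw lw] Fk wk]]]].
  exists (fun=> u a), [set u a]; rewrite /x_ mulr0n addr0; split=> //.
  - by move=> x; exact: cvg_cst.
  - split=> [x /andP[ax _] xa|t ta].
      by have -> : x = a by [lra]; rewrite subrr normr0 ltW.
    by rewrite (_ : _ @^-1` _ = set0)//; apply/seteqP; split=> // x /= /esym.
pose D := u (x_ k.+1) - u (x_ k).
(* The parenthesis divided by [2 * h] is a ramp: 0 up to [x_ k], 1 from [x_ k.+1] on, and affine in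
   between. Adding [D] times it leaves [w] unchanged to the left and moves the final constant to
   [u (x_ k.+1)]. *)
pose w' x := w x + D / (2 * h) * (`|x - x_ k| - `|x - x_ k.+1| + h).
have h2 : 2 * h != 0 by rewrite mulf_neq0// ?lt0r_neq0.
have w'l x : x <= x_ k -> w' x = w x.
  move=> xk; rewrite /w' !ler0_norm ?xS; [|lra|lra].
  by rewrite (_ : _ + h = 0) ?mulr0 ?addr0//; ring.
have w'm x : x_ k <= x -> x <= x_ k.+1 -> w' x = u (x_ k) + D * ((x - x_ k) / h).
  move=> kx; rewrite xS => xk; have A : 0 <= x - x_ k by lra.
  have B : x - (x_ k + h) <= 0 by lra.
  rewrite /w' wk// xS (ger0_norm A) (ler0_norm B).
  congr (_ + _); field; exact: lt0r_neq0.
have w'r x : x_ k.+1 <= x -> w' x = u (x_ k.+1).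
  move=> kx; have kx' : x_ k <= x by move: kx; rewrite xS; lra.
  rewrite /w' wk// !ger0_norm ?subr_ge0// xS.
  rewrite (_ : _ - _ + h = 2 * h); last by ring.
  by rewrite divfK// /D xS addrC subrK.
exists w', (F `|` [set u (x_ k.+1)]); split=> //.
- move=> x; apply: cvgD; first exact: cw.
  apply: cvgM; first exact: cvg_cst.
  apply: cvgD; last exact: cvg_cst.
  by apply: cvgB; apply: cvg_norm; apply: cvgB => //; exact: cvg_cst.
- by rewrite finite_setU; split.
- split=> [x xab xk|t /not_orP[Ft tk]].
    have [xk'|/ltW kx] := leP x (x_ k); first by rewrite w'l// uw.
    (* [w' x] is a convex combination of [u (x_ k)] and [u (x_ k.+1)], both within [e] of [u x]. *)
    rewrite w'm//; set l := _ / h.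
    have l0 : 0 <= l by rewrite divr_ge0 ?subr_ge0// ltW.
    have l1 : l <= 1 by rewrite ler_pdivrMr// mul1r; move: xk; rewrite xS; lra.
    have /ltW : `|u x - u (x_ k)| < e.
      by apply: ud => //; rewrite ger0_norm; move: xk; rewrite xS; lra.
    have /ltW : `|u x - u (x_ k.+1)| < e.
      by apply: ud => //; rewrite ler0_norm; move: xk; rewrite xS; lra.
    rewrite !ler_norml /D => /andP[A1 A2] /andP[A3 A4]; apply/andP; split; nra.
  apply: (@sub_finite_set _ _
    (w @^-1` [set t] `|` [set x_ k + h * ((t - u (x_ k)) / D)])); last first.
    by rewrite finite_setU; split=> //; exact: lw.
  move=> x /= w'x; have [xk|/ltW kx] := leP x (x_ k); first by left; rewrite -w'l.
  have [xk|/ltW xk] := leP x (x_ k.+1); last by rewrite w'r// in w'x; case: tk.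
  rewrite w'm// in w'x; right.
  (* A horizontal piece has the level [u (x_ k)], which [F] contains; any other piece meets the
     level [t] at most once. *)
  have [D0|D0] := eqVneq D 0; first by rewrite D0 mul0r addr0 in w'x; rewrite -w'x in Ft.
  rewrite -w'x /=; field; by rewrite D0 lt0r_neq0.
- by right.
Unshelve. all: by end_near. Qed.

Lemma finite_set_notin_near (R : realType) (F : set R) (x e : R) :
  finite_set F -> 0 < e -> exists2 t, ~ F t & `|x - t| < e.
Proof.
move=> finF e0; apply: contrapT => noF.
(* Infinitely many distinct points; starting the denominators at 2 keeps them at distance strictly
   less than [e]. *)
pose f (k : nat) : R := x + e / k.+2%:R.
apply: infinite_nat; rewrite (_ : setT = f @^-1` F).
  apply: finite_preimage finF => k l _ _ /addrI /(mulfI (lt0r_neq0 e0)) /invr_inj.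
  by move=> /eqP; rewrite eqr_nat => /eqP [].
apply/seteqP; split=> // k _; apply: contrapT => Ff; apply: noF; exists (f k) => //.
rewrite opprD addNKr normrN ger0_norm ?divr_ge0// 1?ltW//.
by rewrite ltr_pdivrMr// ltr_pMr// ltr1n.
Qed.

(** * A local criterion for finite disjoint unions of segments *)

Lemma finite_no_three_increasing (R : realType) (S : set R) :
  (forall x y z, S x -> S y -> S z -> x < y -> y < z -> False) -> finite_set S.
Proof.
move=> S3; have [[x [y [Sx Sy xy]]]|S2] :=
  pselect (exists x y, [/\ S x, S y & x < y]).
  apply: (@sub_finite_set _ _ [set x; y]); last exact: finite_set2.
  move=> z Sz /=; have [zx|zx|->] := ltgtP z x; [|right|by left].
    by case: (S3 z x y).
  have [zy|zy|->//] := ltgtP z y; first by case: (S3 x z y).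
  by case: (S3 x y z).
have [->|/set0P[x Sx]] := eqVneq S set0; first exact: finite_set0.
apply: (@sub_finite_set _ _ [set x]); last exact: finite_set1.
by move=> z Sz /=; have [zx|zx|->//] := ltgtP z x; case: S2;
  [exists z, x|exists x, z].
Qed.

Lemma compact_locally_finite (T : ptopologicalType) (K S : set T) :
  compact K -> S `<=` K ->
  (forall x, K x -> exists U, [/\ open U, U x & finite_set (S `&` U)]) ->
  finite_set S.
Proof.
move=> cK SK locfin.
have /choice[U UP] : forall x, exists U, K x -> [/\ open U, U x & finite_set (S `&` U)].
  move=> x; have [Kx|nKx] := pselect (K x); last by exists setT.
  by have [U ?] := locfin x Kx; exists U.
move: (cK); rewrite compact_cover => /(_ T K U) [|x Kx|D DK KD].
- by move=> x /UP[].
- by exists x => //; have [] := UP x Kx.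
have : finite_set (\bigcup_(x in [set` D]) (S `&` U x)).
  apply: bigcup_finite; first exact: finite_fset.
  by move=> x /DK /set_mem /UP[].
apply: sub_finite_set => x Sx.
by have [y Dy Uyx] := KD x (SK x Sx); exists y.
Qed.

(* The components of [X] start at the points of [A], the points of [X] that are
   not the right end of a segment contained in [X].  If all points near [x]
   surrounded by gaps near [x] lie outside [X], then [A] has at most two points
   near [x]: of three of them the middle one would be surrounded by gaps. *)
Lemma finite_disjoint_union_itvcc_locally (R : realType) (X : set R) :
  compact X ->
  (forall x, X x -> exists2 d : R, 0 < d & forall p y q : R, `|x - p| < d ->
    `|x - q| < d -> p < y -> y < q -> ~ X p -> ~ X q -> ~ X y) ->
  finite_disjoint_union_itvcc X.
Proof.
move=> cX gap.
have clX : closed X by exact: compact_closed (@Rhausdorff R) cX.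
have [M XM] : exists M, forall x, X x -> x <= M.
  have [M [_ HM]] := compact_bounded cX; exists (M + 1) => x Xx.
  by apply: le_trans (ler_norm x) (HM (M + 1) _ _ Xx); rewrite ltrDl.
have [m Xm] : exists m, forall x, X x -> m <= x.
  have [N [_ HN]] := compact_bounded cX; exists (- (N + 1)) => x Xx.
  have : `|x| <= N + 1 by apply: (HN (N + 1) _ _ Xx); rewrite ltrDl.
  by rewrite ler_norml => /andP[].
pose A := [set a | X a /\ forall d : R, 0 < d -> exists p : R, [/\ a - d < p, p < a & ~ X p]].
have finA : finite_set A.
  apply: (compact_locally_finite cX) => [a []//|x Xx].
  have [d d0 xd] := gap x Xx; exists (ball x d); split.
  - exact: ball_open.
  - exact: ballxx.
  apply: finite_no_three_increasing => a1 a2 a3.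
  rewrite -ball_normE /ball_ /= => -[A1 B1] [A2 B2] [A3 B3] a12 a23.
  have [p [p1 p2 Xp]] := A2.2 (a2 - a1) ltac:(lra).
  have [q [q1 q2 Xq]] := A3.2 (a3 - a2) ltac:(lra).
  move: B1 B2 B3; rewrite !ltr_norml => /andP[? ?] /andP[? ?] /andP[? ?].
  by apply: (xd p a2 q _ _ _ _ Xp Xq A2.1); rewrite ?ltr_norml; lra.
(* For [a] in [X], [b a] is the right end of the component of [a]. It belongs to [X] because [X] is
   closed. *)
pose L a := [set y | a <= y /\ forall z, a <= z <= y -> X z].
pose b a := sup (L a).
have La a : X a -> L a a.
  by move=> Xa; split=> // z /le_anti <-.
have Lub a : X a -> has_sup (L a).
  move=> Xa; split; first by exists a; exact: La.
  by exists M => y [ay aX]; apply/XM/aX; rewrite ay lexx.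
have ab_le a : X a -> a <= b a by move=> Xa; apply: ub_le_sup (Lub a Xa).2 _ (La a Xa).
have abX a z : X a -> a <= z <= b a -> X z.
  move=> Xa /andP[az]; rewrite le_eqVlt => /predU1P[->|zb].
    apply: clX => B /nbhs_ballP[e /= e0 eB].
    have [y [ay aX] yb] := sup_adherent e0 (Lub a Xa).
    exists y; split; first by apply: aX; rewrite ay lexx.
    apply: eB; rewrite -ball_normE /ball_ /= ger0_norm ?subr_ge0.
      by rewrite -/(b a) in yb; lra.
    by apply: ub_le_sup (Lub a Xa).2 _ _; split.
  have [y [ay aX] zy] := sup_gt (Lub a Xa).1 zb.
  by apply: aX; rewrite az ltW.
(* A point outside [X] shortly after [a], together with one shortly before [a], would surround [a];
   hence a segment to the right of [a] lies in [X]. *)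
have ab a : A a -> a < b a.
  move=> [Xa Aa]; have [d d0 ad] := gap a Xa.
  have [p [pa pa' Xp]] := Aa d d0.
  apply: (@lt_le_trans _ _ (a + d / 2)); first by lra.
  apply: ub_le_sup (Lub a Xa).2 _ _; split; first by lra.
  move=> z /andP[az zd]; apply: contrapT => Xz.
  have az' : a < z.
    by rewrite lt_neqAle az andbT; apply/eqP => az'; rewrite -az' in Xz.
  by apply: (ad p a z _ _ _ _ Xp Xz Xa); rewrite ?ltr_norml; lra.
have cover x : X x -> exists2 a, A a & a <= x <= b a.
  (* The component of [x] starts at the infimum of [B], which lies in [X] because [X] is closed. *)
  move=> Xx; pose B := [set y | y <= x /\ forall z, y <= z <= x -> X z].
  have Bx : B x by split=> // z /le_anti <-.
  have infB : has_inf B.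
    split; first by exists x.
    by exists m => y [yx yX]; apply/Xm/yX; rewrite lexx yx.
  pose a := inf B.
  have ax : a <= x by apply: ge_inf infB.2 _ Bx.
  have aX z : a < z <= x -> X z.
    move=> /andP[az zx]; have [y [yx yX] yz] := inf_lt infB.1 az.
    by apply: yX; rewrite (ltW yz).
  have Xa : X a.
    apply: clX => C /nbhs_ballP[e /= e0 eC].
    have [y [yx yX] ya] := inf_adherent e0 infB.
    exists y; split; first by apply: yX; rewrite lexx.
    apply: eC; rewrite -ball_normE /ball_ /= ler0_norm ?subr_le0.
      by rewrite -/a in ya; lra.
    by apply: ge_inf infB.2 _ _; split.
  have aX' z : a <= z <= x -> X z.
    by rewrite le_eqVlt => /andP[/predU1P[<-//|az] zx]; apply: aX; rewrite az.
  exists a; last by rewrite ax; apply: ub_le_sup (Lub a Xa).2 _ _; split.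
  (* If [X] contained all of []a - d, a[], then [a - d / 2] would belong to [B], although it is
     below the infimum. *)
  split=> // d d0; apply: contrapT => nop.
  have : a <= a - d / 2.
    apply: ge_inf infB.2 _ _; split; first by lra.
    move=> z /andP[z1 z2]; have [az|za] := leP a z; first by apply: aX'; rewrite az.
    by apply: contrapT => Xz; apply: nop; exists z; split=> //; lra.
  lra.
have disjoint a a' z : A a -> A a' -> a < a' -> a <= z <= b a ->
    a' <= z <= b a' -> False.
  move=> [Xa _] [Xa' Aa'] aa' /andP[az zb] /andP[a'z zb'].
  (* A point [p] outside [X] between [a] and [a'] would satisfy [a < p < a' <= z <= b a]. *)
  have [p [p1 p2 Xp]] := Aa' (a' - a) ltac:(lra).
  by apply: Xp; apply: (abX a) => //; lra.
have [s As] := (finite_seqP _).1 finA.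
(* Removing repetitions makes distinct indices give distinct left ends, as disjointness requires. *)
pose t := undup s.
have At i : (i < size t)%N -> A t`_i by move=> it; rewrite As /= -mem_undup mem_nth.
exists (size t), (fun i => t`_i), (fun i => b t`_i); split.
- by move=> i; apply/ab/At.
- move=> i j _ _ [z [/=]]; rewrite !in_itv /= => zi zj; apply/val_inj/eqP.
  rewrite -(nth_uniq 0 (ltn_ord i) (ltn_ord j) (undup_uniq s)).
  have [ij|ij|//] := ltgtP t`_i t`_j; exfalso.
    by apply: disjoint ij zi zj; exact: At.
  by apply: disjoint ij zj zi; exact: At.
- apply/seteqP; split=> [x /cover[a Aa xa]|x [i _ /=]].
    have at_ : a \in t by rewrite mem_undup; move: Aa; rewrite As.
    have it : (index a t < size t)%N by rewrite index_mem.
    by exists (Ordinal it) => //=; rewrite in_itv /= nth_index.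
  by rewrite in_itv /=; apply: abX; have [] := At i (ltn_ord i).
Qed.

(** * Finite disjoint unions of segments: density fails *)

(** A crossing is a common zero of [u x - u' y] and [v' y - v x]. The opposite orders of subtraction
    give both differences the signs that [poincare_miranda] requires. *)
Lemma paths_cross (R : realType) (u v u' v' : R -> R) (a b a' b' : R) :
  a <= b -> a' <= b' ->
  continuous u -> continuous v -> continuous u' -> continuous v' ->
  (forall y, a' <= y <= b' -> u a < u' y) ->
  (forall y, a' <= y <= b' -> u' y < u b) ->
  (forall x, a <= x <= b -> v' a' < v x) ->
  (forall x, a <= x <= b -> v x < v' b') ->
  exists x y, [/\ a <= x <= b, a' <= y <= b', u x = u' y & v x = v' y].
Proof.
move=> ab ab' cu cv cu' cv' ua ub va vb.
have [||||||||x [y [xab yab /eqP uxy /eqP vxy]]] := @poincare_miranda R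
  (fun p => u p.1 - u' p.2) (fun p => v' p.2 - v p.1) a b a' b' => //.
- move=> p; apply: cvgB; apply: continuous_comp;
    [exact: cvg_fst|exact: cu|exact: cvg_snd|exact: cu'].
- move=> p; apply: cvgB; apply: continuous_comp;
    [exact: cvg_snd|exact: cv'|exact: cvg_fst|exact: cv].
- by move=> y /ua /=; rewrite subr_lt0.
- by move=> y /ub /=; rewrite subr_gt0.
- by move=> y /va /=; rewrite subr_lt0.
- by move=> y /vb /=; rewrite subr_gt0.
exists x, y; split=> //; apply/eqP; first by rewrite -subr_eq0.
by rewrite eq_sym -subr_eq0.
Qed.

Section disconnected_spectrum.
Context {R : realType} {X : set R} {cX : compact X}.

Lemma disconnected_not_dense : X !=set0 -> finite_disjoint_union_itvcc X ->
  ~ dense [set f : cfun cX | ~ connected (spectrum f)].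
Proof.
move=> [x0 Xx0] [n [a [b [ab tI XE]]]] /cfun_denseP dX.
have [i0 _ _] : (\bigcup_(i : 'I_n) [set` `[a i, b i]]) x0 by rewrite -XE.
pose w i (x : R) := (x - a i) / (b i - a i) * 2 - 1.
have cw i : continuous (w i).
  move=> x; apply: cvgB; last exact: cvg_cst.
  apply: cvgMl; apply: cvgMl; apply: cvgB => //; exact: cvg_cst.
have wa i : w i (a i) = - 1 by rewrite /w subrr !mul0r sub0r.
have wb i : w i (b i) = 1.
  by rewrite /w divff ?subr_eq0 ?gt_eqF// mul1r; lra.
pose u0 i x := if i == i0 then w i x else 0.
pose v0 i x := if i == i0 then 0 else w i x.
have cu0 i : continuous (u0 i).
  by rewrite /u0; case: eqP => // _ x; exact: cvg_cst.
have cv0 i : continuous (v0 i).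
  by rewrite /v0; case: eqP => // _ x; exact: cvg_cst.
have XI : X `<=` \bigcup_i [set` `[a i, b i]] by rewrite {1}XE.
have [f fE] := @cfun_glue R X cX _ _ u0 v0
  (fun i => @interval_closed R (BLeft (a i)) (BRight (b i)) isT isT) tI XI cu0 cv0.
(* With the tolerance 1/2, on segment [i0] the real part of [g] passes from below -1/2 to above 1/2
   while its imaginary part stays strictly between these values. On the other segments the roles are
   exchanged, so [paths_cross] applies. *)
have [g gconn fg] := dX f (1 / 2) ltac:(lra).
have [u [v [cu cv gE]]] := cfun_Re_Im g.
apply: gconn; rewrite spectrumE.
have IX i x : a i <= x <= b i -> X x.
  by move=> xi; rewrite XE; exists i => //=; rewrite in_itv.
have close i x : a i <= x <= b i -> `|u0 i x - u x| < 1 / 2 /\ `|v0 i x - v x| < 1 / 2.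
  move=> xi; pose y : X := exist _ x (mem_set (IX i x xi)).
  have : complex.Re `|f y - g y| < 1 / 2.
    exact: le_lt_trans (supnorm_ge (f - g) y) fg.
  rewrite (fE i) /= ?in_itv//= gE /= => fgy.
  by split; apply: le_lt_trans fgy; [exact: (normr_Re_le (Complex _ _ - Complex _ _))
    |exact: (normr_Im_le (Complex _ _ - Complex _ _))].
pose G x : R[i] := Complex (u x) (v x).
pose K i := G @` [set` `[a i, b i]].
have cK i : connected (K i).
  apply: connected_continuous_connected; first exact: segment_connected.
  by apply: continuous_subspaceT; exact: continuous_complex.
have meet i : (K i0 `&` K i) !=set0.
  have [->|ii0] := eqVneq i i0.
    by exists (G (a i0)); split; exists (a i0) => //=; rewrite in_itv /= lexx ltW.
  have hu y : a i <= y <= b i -> - (1 / 2) < u y < 1 / 2.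
    by move=> /close[+ _]; rewrite /u0 (negbTE ii0) sub0r normrN ltr_norml.
  have hv y : a i0 <= y <= b i0 -> - (1 / 2) < v y < 1 / 2.
    by move=> /close[_ +]; rewrite /v0 eqxx sub0r normrN ltr_norml.
  have ua0 : u (a i0) < - (1 / 2).
    have [+ _] := close i0 (a i0) ltac:(by rewrite lexx ltW).
    by rewrite /u0 eqxx wa ltr_norml; lra.
  have ub0 : 1 / 2 < u (b i0).
    have [+ _] := close i0 (b i0) ltac:(by rewrite lexx ltW).
    by rewrite /u0 eqxx wb ltr_norml; lra.
  have va0 : v (a i) < - (1 / 2).
    have [_ +] := close i (a i) ltac:(by rewrite lexx ltW).
    by rewrite /v0 (negbTE ii0) wa ltr_norml; lra.
  have vb0 : 1 / 2 < v (b i).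
    have [_ +] := close i (b i) ltac:(by rewrite lexx ltW).
    by rewrite /v0 (negbTE ii0) wb ltr_norml; lra.
  have [y /hu|y /hu|x /hv|x /hv|x [y [xi yi uxy vxy]]] :=
    @paths_cross R u v u v _ _ _ _ (ltW (ab i0)) (ltW (ab i)) cu cv cu cv; first by lra.
  - by lra.
  - by lra.
  - by lra.
  exists (G x); split; first by exists x => //; rewrite /= in_itv.
  by exists y; [rewrite /= in_itv|rewrite /G uxy vxy].
(* Each [K i0] united with [K i] is connected, and all these unions share the point [G (a i0)]. *)
have -> : range g = \bigcup_i (K i0 `|` K i).
  apply/seteqP; split=> [_ [x _ <-]|z [i _ [|] [x]]].
  - have [i _ xi] := XI (val x) (set_mem (valP x)).
    by exists i => //; right; exists (val x) => //; rewrite gE.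
  - rewrite /= in_itv /= => /IX Xx <-.
    by exists (exist _ x (mem_set Xx)) => //; rewrite gE.
  - rewrite /= in_itv /= => /IX Xx <-.
    by exists (exist _ x (mem_set Xx)) => //; rewrite gE.
apply: bigcup_connected => [|i _]; last exact: connectedU.
exists (G (a i0)) => i _; left; exists (a i0) => //=.
by rewrite in_itv /= lexx/= ltW.
Qed.

(** * All other compact sets: density holds *)

Lemma disconnected_dense (x1 x2 : R) : X x1 -> X x2 -> x1 != x2 ->
  ~ finite_disjoint_union_itvcc X ->
  dense [set f : cfun cX | ~ connected (spectrum f)].
Proof.
move=> Xx1 Xx2 x12 XnI; apply/cfun_denseP => f e e0.
have clX : closed X by exact: compact_closed (@Rhausdorff R) cX.
have [x0 [Xx0 gap]] : exists x0, X x0 /\ forall d : R, 0 < d ->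
    exists p y q : R, [/\ `|x0 - p| < d, `|x0 - q| < d, p < y < q, ~ X p /\ ~ X q & X y].
  apply: contrapT => nogap; apply: XnI.
  apply: (finite_disjoint_union_itvcc_locally cX) => x Xx.
  apply: contrapT => nod; apply: nogap; exists x; split=> // d d0.
  apply: contrapT => nop; apply: nod; exists d => // p y q xp xq py yq Xp Xq Xy.
  by apply: nop; exists p, y, q; split=> //; rewrite py.
have [u [v [cu cv fE]]] := cfun_Re_Im f.
(* On [K] each of the two parts will differ from that of [f] by at most [2 * h], elsewhere only the
   real part differs, by at most [h]. The total is at most [4 * h < e]. *)
pose h := e / 9; have h0 : 0 < h by rewrite divr_gt0.
have x12' : 0 < `|x1 - x2| by rewrite normr_gt0 subr_eq0.
(* The bound on [2 * d] prevents []p, q[], of length less than [2 * d], from containing both [x1]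
   and [x2]; thus [K'] will be nonempty. *)
have [d [d0 ud vd dx]] : exists d, [/\ 0 < d,
    forall x, `|x0 - x| < d -> `|u x0 - u x| < h,
    forall x, `|x0 - x| < d -> `|v x0 - v x| < h & 2 * d <= `|x1 - x2| ].
  have /cvgrPdist_lt/(_ _ h0)/nbhs_ballP[r /= r0 ur] := cu x0.
  have /cvgrPdist_lt/(_ _ h0)/nbhs_ballP[s /= s0 vs] := cv x0.
  exists (Num.min (`|x1 - x2| / 2) (Num.min r s)); split.
  - by rewrite !lt_min r0 s0 divr_gt0.
  - by move=> x; rewrite !lt_min => /and3P[_ xr _]; apply: ur;
      rewrite -ball_normE.
  - by move=> x; rewrite !lt_min => /and3P[_ _ xs]; apply: vs;
      rewrite -ball_normE.
  - by rewrite mulrC -ler_pdivlMr// ge_min lexx.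
have [p [y [q [x0p x0q /andP[py yq] [Xp Xq] Xy]]]] := gap d d0.
(* Since [p] and [q] are outside [X], cutting with the closed interval here and removing the open
   one in [K'] gives two disjoint closed sets that cover [X]. *)
pose K := [set x | X x /\ p <= x <= q].
have KE x : X x -> p <= x <= q -> p < x < q.
  move=> Xx /andP[]; rewrite !le_eqVlt => /predU1P[px|->]; first by rewrite px in Xp.
  by move=> /predU1P[xq|->//]; rewrite -xq in Xq.
pose K' := X `\` `]p, q[%classic.
have cK' : compact K'.
  apply: (subclosed_compact _ cX); last by move=> x [].
  apply: closedI => //; apply: open_closedC; exact: interval_open.
have clK' := compact_closed (@Rhausdorff R) cK'.
have [M XM] : exists M, forall x, X x -> `|x| <= M.
  have [M [_ HM]] := compact_bounded cX; exists (M + 1) => x Xx.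
  by apply: (HM (M + 1) _ _ Xx); rewrite ltrDl.
have [w [F [cw finF uw lw]]] := finite_levels_approx (- M) M cu h0.
have [t Ft ut] := finite_set_notin_near (u x0) finF h0.
have [s Fs vs] := finite_set_notin_near (v x0) (finite_image v (lw t Ft)) h0.
pose A (i : bool) := if i then K else K'.
have clA i : closed (A i).
  case: i => //=; rewrite /K (_ : [set _ | _] = X `&` `[p, q]%classic).
    by apply: closedI => //; exact: interval_closed.
  by apply/seteqP; split=> x /=; rewrite in_itv.
have tA : trivIset setT A.
  by move=> [] [] _ _ // [x] /= [] [];
    [move=> Xx /(KE _ Xx) xpq [_]|move=> Xx + [_ /(KE _ Xx) xpq]];
    rewrite /= in_itv /= xpq.
have XA : X `<=` \bigcup_i A i.
  move=> x Xx; have [xpq|xpq] := boolP (p < x < q).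
    by exists true => //; split=> //; move: xpq => /andP[/ltW -> /ltW ->].
  by exists false => //; split=> //=; rewrite in_itv /=; exact/negP.
pose u' i := if i then fun=> t else w.
pose v' i := if i then fun=> s else v.
have cu' i : continuous (u' i) by case: i => // x; exact: cvg_cst.
have cv' i : continuous (v' i) by case: i => // x; exact: cvg_cst.
have [g gE] := @cfun_glue R X cX _ A u' v' clA tA XA cu' cv'.
exists g; last first.
  have e2 : 4 * h < e by rewrite /h; lra.
  apply: le_lt_trans e2; apply: supnorm_le => [|x]; first by rewrite mulr_ge0// ltW.
  rewrite -[(f - g) x]/(f x - g x); apply: le_trans (Re_normc_le _) _.
  have Xx := set_mem (valP x); have [[] _ Ax] := XA _ Xx.
    rewrite (gE true) // fE /=; have [_ /(KE _ Xx)/andP[px xq]] := Ax.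
    have xd : `|x0 - val x| < d.
      by move: x0p x0q; rewrite !ltr_norml => /andP[? ?] /andP[? ?]; lra.
    have := ud _ xd; have := vd _ xd; move: ut vs.
    rewrite !ltr_norml => /andP[? ?] /andP[? ?] /andP[? ?] /andP[? ?].
    have A1 : `|u (val x) - t| <= 2 * h by rewrite ler_norml; lra.
    have A2 : `|v (val x) - s| <= 2 * h by rewrite ler_norml; lra.
    by lra.
  rewrite (gE false) // fE /= subrr normr0 addr0.
  apply: le_trans (uw _ _) _; last by lra.
  by have := XM _ Xx; rewrite ler_norml.
rewrite /= spectrumE => gconn.
pose c : R[i] := Complex t s.
pose C := (fun x => Complex (w x) (v x) : R[i]) @` K'.
have clC : closed C.
  apply: compact_closed; first exact: norm_hausdorff.
  apply: continuous_compact => //.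
  by apply: continuous_subspaceT; exact: continuous_complex.
have Cc : ~ C c.
  by move=> [x _ [wx vx]]; apply: Fs; exists x.
have gK (z : X) : K (val z) -> g z = c by move=> Kz; rewrite (gE true).
have gK' (z : X) : K' (val z) -> C (g z).
  by move=> Kz; rewrite (gE false)//; exists (val z).
have gc (z : X) : g z = c \/ C (g z).
  by have [[] _ Az] := XA _ (set_mem (valP z)); [left; exact: gK|right; exact: gK'].
have cg : range g c.
  exists (exist _ y (mem_set Xy)) => //; apply: gK; split=> //=.
  by rewrite !ltW.
(* The point [c] is closed, and it is open in the range because the rest of the range lies in the
   closed set [C], which omits [c]. A connected range would reduce to [c], whereas [g] takes values
   in [C] on the nonempty [K']. *)
have gcE : [set c] = range g.
  apply: gconn; first by exists c.
  - exists (~` C); first exact: closed_openC.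
    apply/seteqP; split=> [z /= -> //|_ [[z _ <-] Cz]].
    by have [] := gc z.
  - exists [set c].
      exact: accessible_closed_set1 (hausdorff_accessible (@norm_hausdorff _ _)) _.
    by apply/seteqP; split=> [z /= ->|z []].
have [x K'x] : K' !=set0.
  have notboth : ~ (p < x1 < q /\ p < x2 < q).
    move=> [/andP[? ?] /andP[? ?]]; move: x0p x0q dx; rewrite !ltr_norml.
    move=> /andP[? ?] /andP[? ?]; apply/negP; rewrite -ltNge ltr_norml; lra.
  have [h1|h1] := boolP (p < x1 < q).
    exists x2; split=> //=; rewrite in_itv /= => h2; exact: notboth.
  by exists x1; split=> //=; rewrite in_itv /=; exact/negP.
have := gK' (exist _ x (mem_set K'x.1)) K'x.
suff -> : g (exist _ x (mem_set K'x.1)) = c by [].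
have : range g (g (exist _ x (mem_set K'x.1))) by exists (exist _ x (mem_set K'x.1)).
by rewrite -gcE.
Qed.

End disconnected_spectrum.

Unset Implicit Arguments.

Theorem proposition3p8 (R : realType) (X : set R) (cX : compact X)
    (X_gt1 : ~~ (X #<= `I_1)) :
  dense [set f : cfun cX | ~ connected (spectrum f)] <->
  ~ finite_disjoint_union_itvcc X.
Proof.
have [x1 [x2 [Xx1 Xx2 x12]]] : exists x1 x2, [/\ X x1, X x2 & x1 != x2].
  apply: contrapT => Xle1; move/negP: X_gt1; apply.
  have [->|/set0P[x Xx]] := eqVneq X set0; first exact: card_ge0.
  apply: (@card_le_trans _ _ _ [set x]); last first.
    by have /card_eqPle[] := @card_set1 _ x.
  apply: subset_card_le => y Xy /=; apply: contrapT => /eqP yx.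
  by apply: Xle1; exists y, x.
split=> [dX XI|]; last exact: disconnected_dense Xx1 Xx2 x12.
by apply: disconnected_not_dense XI dX; exists x1.
Qed.
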